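(* Let $\delta=\Theta(n^{-\beta})$ with $\beta\in[0,7/68]$. There exist constants $C$ and $N$ such that, with $$h=\frac14\left(\frac{\delta}{d+1}\right)^{1/3}\left(\frac{p(1-p)n}{\log n}\right)^{1/6},$$ for all $d\ge 2$, $n\ge N$, and $$p\in\left[Cd\log n\left(\frac{d^2}{\delta^2 n}\right)^{1/7},\ \frac12\right],$$ the random graph $G(n,p)$ is $(h,d+1,2d+1)$-separated with probability at least $1-\delta$.
   Context: $G(n,p)$ is the Erdős–Rényi random graph on $n$ vertices where each edge is present independently with probability $p$. For a graph, sort the vertices by degree so that $d(v_1)\ge d(v_2)\ge\cdots\ge d(v_n)$. For a vertex $v$, $\mathrm{sig}(v)$ is the $h$-bit string whose $i$th bit indicates whether $v$ is adjacent to $v_i$. The graph is $(h,a,b)$-separated if (i) for all $i\in[h-1]$, $d(v_i)-d(v_{i+1})\ge a$, and (ii) for all distinct $i,j\in\{h+1,\ldots,n\}$, the Hamming distance between $\mathrm{sig}(v_i)$ and $\mathrm{sig}(v_j)$ is at least $b$. *)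

(* Defs.v *)
From mathcomp Require Import all_boot all_order all_algebra all_fingroup.

Set Implicit Arguments.
Unset Strict Implicit.
Unset Printing Implicit Defensive.

Import GRing.Theory.

Section Graphs.
Variable n : nat.

Definition vertex_pairs : {set {set 'I_n}} := [set e : {set 'I_n} | #|e| == 2].

(* A simple graph on 'I_n is its edge set E \subset vertex_pairs; then
   [set u; u] is never an edge, so adj E is irreflexive. *)
Definition adj (E : {set {set 'I_n}}) : rel 'I_n := [rel u w | [set u; w] \in E].

Definition degree (E : {set {set 'I_n}}) (u : 'I_n) : nat := #|[set w | adj E u w]|.

(* Ranks are 0-based throughout: v i is the vertex v_{i+1} of the usual
   1-based enumeration. *)
Definition degree_sorted (E : {set {set 'I_n}}) (v : 'S_n) : bool :=
  [forall i : 'I_n, forall j : 'I_n,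
     (i <= j) ==> (degree E (v j) <= degree E (v i))].

Definition sig (E : {set {set 'I_n}}) (v : 'S_n) (h : nat) (u : 'I_n) : seq bool :=
  [seq adj E u (v i) | i <- take h (enum 'I_n)].

Definition hamming (s t : seq bool) : nat :=
  count (fun xy : bool * bool => xy.1 != xy.2) (zip s t).

(* When several vertices have the same degree the sorted enumeration is not
   unique; the condition is required for every admissible enumeration. *)
Definition hab_separated (h a b : nat) (E : {set {set 'I_n}}) : bool :=
  [forall v : 'S_n, degree_sorted E v ==>
     [forall i : 'I_n, forall j : 'I_n,
        ((j == i.+1 :> nat) && (j < h)) ==>
          (degree E (v j) + a <= degree E (v i))] &&
     [forall i : 'I_n, forall j : 'I_n,
        [&& i != j, h <= i & h <= j] ==>
          (b <= hamming (sig E v h (v i)) (sig E v h (v j)))]].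

End Graphs.

Local Open Scope ring_scope.

(* Probability that the edge set of G(n,p) satisfies A; it is a probability
   for 0 <= p <= 1. *)
Definition Gnp_prob (R : realFieldType) (n : nat) (p : R)
    (A : pred {set {set 'I_n}}) : R :=
  \sum_(E in powerset (vertex_pairs n) | A E)
    \prod_(e in vertex_pairs n) (if e \in E then p else 1 - p).

(* Main.v *)
Require Import Defs.
From mathcomp Require Import all_boot all_order all_fingroup all_algebra.
From mathcomp Require Import ring lra zify.

(* Write q = 1 - p, L = ln n, s = sqrt (p q n / L), so that
   delta s = 64 (d + 1) h^3, and let b be the binomial (n - 2, p) mass function.
   Let K be the largest integer with n b(K) >= rho := 512 h / s.  It lies past
   the mode and, by Chernoff, below the mean plus 6 s L, where b decays slowly;
   hence about s rho vertices, i.e. at least 4 h, are expected to have degree at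
   least K + 2, and since degrees are almost uncorrelated, Chebyshev makes their
   number at least h outside an event of probability O(1 / h) <= delta / 4 (this
   is where beta <= 7 / 68 enters).  As n b <= rho beyond K, the expected number
   of pairs of such vertices with degrees within d is O(h L (d + 1) rho) =
   O(delta L / h) <= delta / 4; this gives the degree gaps.
   For the signatures of u and w: gaps of at least d + 1 >= 3 allow one to read
   off the top h - 1 vertices from the graph with u and w removed, which is
   independent of the edges at u and w.  So the Hamming distance dominates a
   binomial (h - 1, 2 p q) variable, and p h >= C d L concludes. *)

Set Implicit Arguments.
Unset Strict Implicit.
Unset Printing Implicit Defensive.

Import Order.TTheory GRing.Theory Num.Theory.
Local Open Scope ring_scope.

(** * Expectation over random subsets *)

(** A finite sum over a ground set [D] kept as a parameter, so that the edge set can be cut into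
    disjoint pieces that are exposed one after the other. *)
Definition Ex (R : realFieldType) (T : finType) (p : R) (D : {set T})
    (f : {set T} -> R) : R :=
  \sum_(E in powerset D) (\prod_(e in D) (if e \in E then p else 1 - p)) * f E.

Section Expectation.
Variables (R : realFieldType) (T : finType) (p : R).
Implicit Types (A B D E : {set T}) (f g : {set T} -> R).

Lemma eq_Ex D f g : (forall E, E \subset D -> f E = g E) -> Ex p D f = Ex p D g.
Proof. by move=> fg; apply: eq_bigr => E; rewrite inE => /fg ->. Qed.

Lemma Ex_sum (I : Type) (r : seq I) (P : pred I) D (F : I -> {set T} -> R) :
  Ex p D (fun E => \sum_(i <- r | P i) F i E) = \sum_(i <- r | P i) Ex p D (F i).
Proof. by rewrite exchange_big; apply: eq_bigr => E _; rewrite mulr_sumr. Qed.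

Lemma ExD D f g : Ex p D (fun E => f E + g E) = Ex p D f + Ex p D g.
Proof. by rewrite -big_split; apply: eq_bigr => E _; rewrite mulrDr. Qed.

Lemma ExZ D c f : Ex p D (fun E => c * f E) = c * Ex p D f.
Proof. by rewrite mulr_sumr; apply: eq_bigr => E _; rewrite mulrCA. Qed.

Lemma Ex_prod D (G : T -> bool -> R) :
  Ex p D (fun E => \prod_(e in D) G e (e \in E)) =
  \prod_(e in D) (p * G e true + (1 - p) * G e false).
Proof.
(* Off [D] the two weights are 0 and 1, so when the product over all of [T] is distributed only the
   subsets of [D] survive. *)
pose F e := if e \in D then p * G e true else 0.
pose F' e := if e \in D then (1 - p) * G e false else 1.
transitivity (\prod_e (F e + F' e)); last first.
  rewrite [RHS]big_mkcond; apply: eq_bigr => e _.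
  by rewrite /F /F'; case: ifP; rewrite ?add0r.
rewrite bigA_distr [RHS](bigID (fun E : {set T} => E \subset D)) /= [X in _ + X]big1 ?addr0.
  rewrite /Ex; apply: eq_big => E; first by rewrite inE.
  rewrite inE => sED; rewrite -big_split /= big_mkcond; apply: eq_bigr => e _.
  rewrite /F /F'; case: (boolP (e \in E)) => [/(subsetP sED) -> //|_].
  by case: ifP.
move=> E /subsetPn[e eE eD]; rewrite (bigD1 e) //= eE /F (negPf eD).
by rewrite mul0r.
Qed.

Lemma Ex_cst D c : Ex p D (fun=> c) = c.
Proof.
have -> : Ex p D (fun=> c) = c * Ex p D (fun E => \prod_(e in D) 1).
  rewrite -ExZ; apply: eq_Ex => E _.
  by rewrite big1 ?mulr1.
rewrite (Ex_prod D (fun _ _ => 1)) big1 ?mulr1 // => e _; ring.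
Qed.

(** Independence of disjoint parts: [E] corresponds to its traces on [A] and [B], and its weight
    splits accordingly. *)
Lemma Ex_setU A B f : [disjoint A & B] ->
  Ex p (A :|: B) f = Ex p A (fun E1 => Ex p B (fun E2 => f (E1 :|: E2))).
Proof.
move=> dAB; have dBA : [disjoint B & A] by rewrite disjoint_sym.
rewrite /Ex; under [RHS]eq_bigr do rewrite mulr_sumr.
rewrite pair_big /= (reindex_onto (fun X : {set T} * {set T} => X.1 :|: X.2)
  (fun E => (E :&: A, E :&: B))) /=; last first.
  by move=> E; rewrite inE => /setIidPl; rewrite setIUr.
apply: eq_big => [[X Y]|[X Y]] /=.
  rewrite !inE; apply/andP/andP => [[sXY /eqP[<- <-]]|[sX sY]].
    by rewrite !subsetIr.
  split; first by rewrite setUSS.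
  have /setIidPl eX := sX; have /setIidPl eY := sY.
  have XB : X :&: B = set0.
    by apply/eqP; rewrite setI_eq0; apply: disjointWl dAB.
  have YA : Y :&: A = set0.
    by apply/eqP; rewrite setI_eq0; apply: disjointWl dBA.
  by rewrite !setIUl eX eY XB YA setU0 set0U.
case/andP=> _ /eqP[eX eY].
have sX : X \subset A by rewrite -eX subsetIr.
have sY : Y \subset B by rewrite -eY subsetIr.
rewrite (_ : \prod_(e in A :|: B) _ = (\prod_(e in A) (if e \in X :|: Y then p else 1 - p)) *
  \prod_(e in B) (if e \in X :|: Y then p else 1 - p)); last first.
  by rewrite -bigU //=; apply: eq_bigl => e; rewrite !inE.
rewrite -mulrA; congr (_ * (_ * _)); apply: eq_bigr => e eD.
  rewrite inE; suff -> : (e \in Y) = false by rewrite orbF.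
  by apply/negP => /(subsetP sY); rewrite (disjointFr dAB).
rewrite inE; suff -> : (e \in X) = false by [].
by apply/negP => /(subsetP sX); rewrite (disjointFr dBA).
Qed.

Lemma Ex_set1 e f : Ex p [set e] f = p * f [set e] + (1 - p) * f set0.
Proof.
rewrite /Ex powerset1 big_setU1 /=; last by rewrite inE eq_sym -cards_eq0 cards1.
by rewrite !big_set1 !inE eqxx addrC.
Qed.

Lemma Ex_card D (g : nat -> R) :
  Ex p D (fun E => g #|E|) =
  \sum_(k < #|D|.+1) 'C(#|D|, k)%:R * p ^+ k * (1 - p) ^+ (#|D| - k) * g k.
Proof.
rewrite /Ex (partition_big (fun E : {set T} => inord #|E| : 'I_#|D|.+1) xpredT) //=.
apply: eq_bigr => k _.
transitivity (\sum_(E in [set E : {set T} | E \subset D & #|E| == k])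
   (p ^+ k * (1 - p) ^+ (#|D| - k) * g k)); last first.
  rewrite sumr_const cards_draws -mulr_natl; ring.
apply: eq_big => E.
  rewrite !inE; apply: andb_id2l => sED; rewrite -val_eqE /= inordK //.
  by rewrite ltnS subset_leq_card.
rewrite inE => /andP[sED /eqP <-].
rewrite inordK ?ltnS ?subset_leq_card //; congr (_ * _).
rewrite (bigID (fun e => e \in E)) /=.
rewrite (eq_bigr (fun=> p)) => [|e /andP[_ ->] //].
rewrite [X in _ * X](eq_bigr (fun=> 1 - p)) => [|e /andP[_ /negPf ->] //].
rewrite !prodr_const; congr (_ ^+ _ * _ ^+ _).
  apply: eq_card => e; rewrite unfold_in /= andb_idl //; apply: (subsetP sED).
by rewrite -cardsDS //; apply: eq_card => e; rewrite unfold_in /= inE andbC.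
Qed.

Hypothesis p01 : 0 <= p <= 1.

Lemma Ex_le D f g : (forall E, E \subset D -> f E <= g E) -> Ex p D f <= Ex p D g.
Proof.
move=> fg; apply: ler_sum => E; rewrite inE => /fg fgE.
apply: ler_wpM2l => //; apply: prodr_ge0 => e _.
by case/andP: p01 => p0 p1; case: ifP; rewrite ?subr_ge0.
Qed.

Lemma Ex_ge0 D f : (forall E, E \subset D -> 0 <= f E) -> 0 <= Ex p D f.
Proof. by move=> f0; rewrite -{1}(Ex_cst D 0); apply: Ex_le. Qed.

End Expectation.

Lemma Ex_imset (R : realFieldType) (T U : finType) (p : R) (h : T -> U)
    (A : {set T}) (f : {set U} -> R) : injective h ->
  Ex p (h @: A) f = Ex p A (fun X => f (h @: X)).
Proof.
move=> injh; rewrite /Ex.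
rewrite (reindex_onto (fun X : {set T} => h @: X) (fun Y => h @^-1: Y)) /=; last first.
  move=> Y; rewrite inE => /subsetP sY; apply/setP => y; apply/imsetP/idP.
    by case=> x; rewrite inE => ? ->.
  move=> yY; have /imsetP[x xA yx] := sY _ yY.
  by exists x => //; rewrite inE -yx.
apply: eq_big => X.
  have -> : h @^-1: (h @: X) = X.
    by apply/setP => x; rewrite inE mem_imset.
  rewrite eqxx andbT !inE; apply/subsetP/subsetP => sX x xX.
    by have := sX (h x); rewrite !mem_imset // => ->.
  by case/imsetP: xX => y yX ->; rewrite mem_imset //; apply: sX.
move=> _; congr (_ * _); rewrite big_imset /=; last by move=> ? ? _ _; apply: injh.
by apply: eq_bigr => x _; rewrite mem_imset.
Qed.

(** * Exposing the edges at two vertices *)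

Section PairDecomposition.
Variables (n : nat) (u w : 'I_n).
Implicit Types (X Y : {set 'I_n}) (E : {set {set 'I_n}}).

Definition star (x : 'I_n) X : {set {set 'I_n}} := [set [set x; y] | y in X].

Definition pairs_off : {set {set 'I_n}} :=
  [set e in vertex_pairs n | (u \notin e) && (w \notin e)].

(* The graph in which u and w are joined iff b, their other neighbours are X
   and Y respectively, and E is the set of edges avoiding both. *)
Definition glue E (b : bool) X Y : {set {set 'I_n}} :=
  E :|: ((if b then [set [set u; w]] else set0) :|: (star u X :|: star w Y)).

Lemma pair_inj (x : 'I_n) : injective (fun y => [set x; y]).
Proof.
move=> y z eyz; have /set2P[yx|//] : y \in [set x; z] by rewrite -eyz set22.
by have /set2P[zx|//] : z \in [set x; y]; rewrite ?eyz ?set22 // zx yx.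
Qed.

Lemma in_star x y X : ([set x; y] \in star x X) = (y \in X).
Proof. by exact: (mem_imset _ _ (@pair_inj x)). Qed.

Lemma notin_star x X (e : {set 'I_n}) : x \notin e -> e \notin star x X.
Proof. by apply: contra => /imsetP[y _ ->]; rewrite set21. Qed.

Hypothesis uw : u != w.
Let W := ~: [set u; w].

Lemma inW x : (x \in W) = (x != u) && (x != w).
Proof. by rewrite !inE negb_or. Qed.

Lemma vertex_pairsU2 :
  vertex_pairs n = pairs_off :|: ([set [set u; w]] :|: (star u W :|: star w W)).
Proof.
have starP (x y : 'I_n) (e : {set 'I_n}) : e \in star x (~: [set x; y]) ->
    #|e| == 2.
  move=> /imsetP[z]; rewrite !inE negb_or => /andP[zx _] ->.
  by rewrite cards2 [x == z]eq_sym zx.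
have starE (x y : 'I_n) (e : {set 'I_n}) : x \in e -> y \notin e -> #|e| == 2 ->
    e \in star x (~: [set x; y]).
  move=> xe ye /cards2P[a [b [ab eE]]]; move: xe ye; rewrite eE => /set2P[->|->].
    rewrite !inE negb_or => /andP[ya yb]; apply/imsetP; exists b => //.
    by rewrite !inE negb_or eq_sym ab eq_sym yb.
  rewrite !inE negb_or => /andP[ya yb]; apply/imsetP; exists a; last by rewrite setUC.
  by rewrite !inE negb_or ab eq_sym ya.
have Wwu : W = ~: [set w; u] by rewrite setUC.
apply/setP => e; rewrite !in_setU !in_set1 [in LHS]inE inE inE.
apply/idP/or3P => [e2|].
  case: (boolP (u \in e)) => ue; case: (boolP (w \in e)) => we.
  - apply: Or32; rewrite eq_sym eqEcard subUset !sub1set ue we /=.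
    by rewrite (eqP e2) cards2 uw.
  - by apply: Or33; rewrite /W starE.
  - by apply: Or33; rewrite Wwu orbC starE.
  - by apply: Or31; rewrite e2.
case=> [/andP[] //|/eqP ->|/orP[]]; first by rewrite cards2 uw.
  exact: starP.
by rewrite Wwu; apply: starP.
Qed.

Lemma star_pairs_disjoint :
  [/\ [disjoint pairs_off & [set [set u; w]] :|: (star u W :|: star w W)],
      [disjoint [set [set u; w]] & star u W :|: star w W]
    & [disjoint star u W & star w W]].
Proof.
have uW : u \notin W by rewrite inW eqxx.
have wW : w \notin W by rewrite inW eqxx andbF.
split.
- rewrite -setI_eq0; apply/eqP/setP => e; rewrite !inE; apply/negP.
  case/andP=> /and3P[_ ue we] /or3P[/eqP e_|/imsetP[x _ e_]|/imsetP[x _ e_]].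
  + by move: ue; rewrite e_ set21.
  + by move: ue; rewrite e_ set21.
  + by move: we; rewrite e_ set21.
- rewrite disjoints1 !inE negb_or in_star wW /=.
  by rewrite setUC in_star.
rewrite -setI_eq0; apply/eqP/setP => e; rewrite !inE; apply/negP.
case/andP=> /imsetP[x xW ->] /imsetP[y yW /setP/(_ u)].
by rewrite !inE eqxx (negPf uw) /= => /esym/eqP uy; rewrite -uy (negPf uW) in yW.
Qed.

(** Exposes the edges at [u] and [w] last: whatever depends only on the other edges is constant in
    the inner average, where the two neighbourhoods are independent. *)
Lemma Ex_pair (R : realFieldType) (p : R) (f : {set {set 'I_n}} -> R) :
  let F E b := Ex p W (fun X => Ex p W (fun Y => f (glue E b X Y))) in
  Ex p (vertex_pairs n) f =
  Ex p pairs_off (fun E => p * F E true + (1 - p) * F E false).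
Proof.
have [d1 d2 d3] := star_pairs_disjoint.
rewrite vertex_pairsU2 Ex_setU //; apply: eq_Ex => E _.
rewrite Ex_setU // Ex_set1.
by rewrite !Ex_setU // !Ex_imset; try exact: pair_inj; congr (_ * _ + _ * _);
  apply: eq_Ex => X _; rewrite Ex_imset //; apply: pair_inj.
Qed.

Section Glue.
Variables (E : {set {set 'I_n}}) (b : bool) (X Y : {set 'I_n}).
Hypotheses (sE : E \subset pairs_off) (sX : X \subset W) (sY : Y \subset W).
Let G := glue E b X Y.

Let notinE (e : {set 'I_n}) : (u \in e) || (w \in e) -> e \in E = false.
Proof.
by move=> uwe; apply/negP => /(subsetP sE); rewrite !inE -negb_or uwe andbF.
Qed.

Lemma adj_glue0 : adj G u w = b.
Proof.
rewrite /adj /= !in_setU notinE ?set21 //= in_star.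
have -> : (w \in X) = false by apply/negP => /(subsetP sX); rewrite inW eqxx andbF.
rewrite [[set u; w]]setUC in_star.
have -> : (u \in Y) = false by apply/negP => /(subsetP sY); rewrite inW eqxx.
by case: b; rewrite ?inE ?eqxx.
Qed.

Lemma adj_gluel x : x \in W -> adj G u x = (x \in X).
Proof.
rewrite inW => /andP[xu xw]; rewrite /adj /= !in_setU notinE ?set21 //= in_star.
have -> : ([set u; x] \in star w Y) = false.
  by apply/negbTE/notin_star; rewrite !inE negb_or eq_sym uw eq_sym.
rewrite orbF; case: b; rewrite ?inE //; case: eqP => //.
by move/pair_inj/eqP; rewrite (negPf xw).
Qed.

Lemma adj_gluer x : x \in W -> adj G w x = (x \in Y).
Proof.
rewrite inW => /andP[xu xw]; rewrite /adj /= !in_setU notinE ?set21 ?orbT //= in_star.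
have -> : ([set w; x] \in star u X) = false.
  by apply/negbTE/notin_star; rewrite !inE negb_or uw eq_sym.
case: b; rewrite ?inE //; case: eqP => //.
by rewrite [[set u; w]]setUC => /pair_inj/eqP; rewrite (negPf xu).
Qed.

Lemma adj_glueW x y : x \in W -> y \in W -> adj G x y = ([set x; y] \in E).
Proof.
rewrite !inW => /andP[xu xw] /andP[yu yw]; rewrite /adj /= !in_setU.
have ue : u \notin [set x; y] by rewrite !inE negb_or eq_sym xu eq_sym.
have we : w \notin [set x; y] by rewrite !inE negb_or eq_sym xw eq_sym.
rewrite (negPf (notin_star _ ue)) (negPf (notin_star _ we)) !orbF.
case: b; rewrite ?inE ?orbF //; case: eqP => [exy|]; last by rewrite orbF.
by rewrite exy set21 in ue.
Qed.

End Glue.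
End PairDecomposition.

Lemma adjC n (E : {set {set 'I_n}}) x y : adj E x y = adj E y x.
Proof. by rewrite /adj /= setUC. Qed.

Lemma adjxx n (E : {set {set 'I_n}}) x : E \subset vertex_pairs n -> adj E x x = false.
Proof.
move=> sE; apply/negP => /(subsetP sE).
by rewrite inE setUid cards1.
Qed.

Lemma glue_sub n (u w : 'I_n) (E : {set {set 'I_n}}) b (X Y : {set 'I_n}) :
  u != w -> E \subset pairs_off u w ->
  X \subset ~: [set u; w] -> Y \subset ~: [set u; w] ->
  glue u w E b X Y \subset vertex_pairs n.
Proof.
move=> uw sE sX sY; rewrite (vertex_pairsU2 uw) setUSS //.
by rewrite !setUSS ?imsetS //; case: b; rewrite ?sub0set.
Qed.

Lemma degree_glue n (u w : 'I_n) (E : {set {set 'I_n}}) b (X Y : {set 'I_n}) :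
  u != w -> E \subset pairs_off u w ->
  X \subset ~: [set u; w] -> Y \subset ~: [set u; w] ->
  degree (glue u w E b X Y) u = (b + #|X|)%N /\
  degree (glue u w E b X Y) w = (b + #|Y|)%N.
Proof.
move=> uw sE sX sY; have sG := glue_sub b uw sE sX sY.
(* Symmetric form, used once for [u] and once for [w]. *)
have D (v v' : 'I_n) (Z : {set 'I_n}) : v != v' -> Z \subset ~: [set v; v'] ->
    (forall x, x \in ~: [set v; v'] -> adj (glue u w E b X Y) v x = (x \in Z)) ->
    adj (glue u w E b X Y) v v' = b ->
    degree (glue u w E b X Y) v = (b + #|Z|)%N.
  move=> vv' sZ adjZ adjb.
  have v'Z : v' \notin Z.
    by apply/negP => /(subsetP sZ); rewrite !inE eqxx orbT.
  have vZ : v \notin Z by apply/negP => /(subsetP sZ); rewrite !inE eqxx.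
  rewrite /degree; transitivity #|(if b then [set v'] else set0) :|: Z|; last first.
    case: (b); last by rewrite set0U.
    by rewrite cardsU1 v'Z.
  apply: eq_card => x; rewrite !inE.
  have [->|xv] := eqVneq x v.
    rewrite [LHS]adjxx // (negPf vZ) orbF; case: (b); rewrite ?inE //.
    by rewrite (negPf vv').
  have [->|xv'] := eqVneq x v'.
    by rewrite [LHS]adjb (negPf v'Z) orbF; case: (b); rewrite !inE ?eqxx.
  rewrite [LHS]adjZ ?inE ?negb_or ?xv //.
  by case: (b); rewrite !inE ?(negPf xv').
split; first apply: (D u w) => //.
- exact: adj_gluel.
- exact: adj_glue0.
apply: (D w u); rewrite 1?eq_sym //; first by rewrite setUC.
  by move=> x; rewrite setUC; apply: adj_gluer.
by rewrite adjC adj_glue0.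
Qed.

(** * Degrees *)

Section Binomial.
Variables (R : realFieldType) (p : R) (m : nat).

Definition bpmf (k : nat) : R := 'C(m, k)%:R * p ^+ k * (1 - p) ^+ (m - k).

Definition btail (k : nat) : R := \sum_(j < m.+1 | (k <= j)%N) bpmf j.

Lemma bpmf_mgf s : \sum_(j < m.+1) bpmf j * s ^+ j = (1 - p + p * s) ^+ m.
Proof.
rewrite exprDn; apply: eq_bigr => j _.
by rewrite /bpmf exprMn -mulr_natl; ring.
Qed.

Lemma bpmf_sum1 : \sum_(j < m.+1) bpmf j = 1.
Proof.
transitivity (\sum_(j < m.+1) bpmf j * 1 ^+ j).
  by apply: eq_bigr => j _; rewrite expr1n mulr1.
by rewrite bpmf_mgf mulr1 subrK expr1n.
Qed.

Lemma btail_sum k : \sum_(j < m.+1) bpmf j * (k <= j)%N%:R = btail k.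
Proof.
rewrite /btail [RHS]big_mkcond; apply: eq_bigr => j _.
by case: ifP; rewrite ?mulr1 ?mulr0.
Qed.

Lemma btailE k : btail k = bpmf k + btail k.+1.
Proof.
case: (ltnP k m.+1) => km.
  rewrite /btail (bigD1 (Ordinal km)) //=; congr (_ + _).
  by apply: eq_bigl => j; rewrite ltn_neqAle -val_eqE andbC eq_sym.
rewrite /bpmf bin_small ?mul0r ?add0r ?mulr1n; last exact: km.
by rewrite /btail !big1 // => j; have := ltn_ord j; lia.
Qed.

Hypothesis p01 : 0 <= p <= 1.

Lemma bpmf_ge0 k : 0 <= bpmf k.
Proof. by case/andP: p01 => p0 p1; rewrite !mulr_ge0 ?exprn_ge0 ?subr_ge0. Qed.

Lemma btail_ge0 k : 0 <= btail k.
Proof. by apply: sumr_ge0 => j _; apply: bpmf_ge0. Qed.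

Lemma btail_le k l : (k <= l)%N -> btail l <= btail k.
Proof.
move=> kl; rewrite -!btail_sum; apply: ler_sum => j _.
rewrite ler_wpM2l ?bpmf_ge0 // ler_nat.
by case: (leqP l j) => // /(leq_trans kl) ->.
Qed.

End Binomial.

Lemma sum_window (R : realFieldType) (m k a : nat) :
  \sum_(j < m | (k <= j < k + a)%N) 1 <= a%:R :> R.
Proof.
have -> : \sum_(j < m | (k <= j < k + a)%N) 1 =
    (\sum_(j < m | (k <= j < k + a)%N) 1)%N%:R :> R by rewrite natr_sum.
rewrite ler_nat.
rewrite -(big_mkord (fun j => k <= j < k + a)%N (fun=> 1%N)) -big_filter sum1_size.
rewrite -[leqRHS](size_iota k); apply: uniq_leq_size.
  by rewrite filter_uniq // iota_uniq.
by move=> j; rewrite mem_filter mem_iota => /andP[].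
Qed.

(** * Joint law of two degrees *)

Section DegreeLaw.
Variables (R : realFieldType) (p : R) (n : nat).
Local Notation V := (vertex_pairs n).
Local Notation b := (bpmf p (n - 2)).
Local Notation B := (btail p (n - 2)).
Hypothesis p01 : 0 <= p <= 1.

(** Given whether [u] and [w] are joined ([c] is 1 or 0), their degrees are [c] plus independent
    binomial (n - 2, p) variables. *)
Lemma Ex_degree2 (u w : 'I_n) (g : nat -> nat -> R) : u != w ->
  let S c := \sum_(j < (n - 2).+1) \sum_(k < (n - 2).+1) b j * b k * g (c + j)%N (c + k)%N in
  Ex p V (fun E => g (degree E u) (degree E w)) = p * S 1%N + (1 - p) * S 0%N.
Proof.
move=> uw S; rewrite (Ex_pair uw).
rewrite -[RHS](Ex_cst p (pairs_off u w)); apply: eq_Ex => E sE.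
have F (c : bool) : Ex p (~: [set u; w]) (fun X => Ex p (~: [set u; w]) (fun Y =>
    g (degree (glue u w E c X Y) u) (degree (glue u w E c X Y) w))) = S c.
  have cW : #|~: [set u; w]| = (n - 2)%N by rewrite cardsCs setCK cards2 uw card_ord.
  under eq_Ex => X sX.
    under eq_Ex => Y sY.
      have [-> ->] := degree_glue c uw sE sX sY; over.
    rewrite (Ex_card p _ (fun k => g (c + #|X|)%N (c + k)%N)) cW; over.
  rewrite (Ex_card p _ (fun j => \sum_(k < (n - 2).+1) _ * g (c + j)%N (c + k)%N)) cW.
  apply: eq_bigr => j _; rewrite mulr_sumr; apply: eq_bigr => k _.
  by rewrite /bpmf; ring.
by rewrite !F.
Qed.

(** A second vertex [w] is singled out so that the marginal law is written with the same n - 2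
    trials as the joint law. *)
Lemma Ex_degree (u w : 'I_n) (g : nat -> R) : u != w ->
  Ex p V (fun E => g (degree E u)) =
  p * (\sum_(j < (n - 2).+1) b j * g j.+1) + (1 - p) * (\sum_(j < (n - 2).+1) b j * g j).
Proof.
move=> uw; rewrite (Ex_degree2 (fun j _ => g j) uw).
have F c : \sum_(j < (n - 2).+1) \sum_(k < (n - 2).+1) b j * b k * g (c + j)%N =
    \sum_(j < (n - 2).+1) b j * g (c + j)%N.
  apply: eq_bigr => j _; rewrite -[RHS]mul1r -(bpmf_sum1 p (n - 2)) mulr_suml.
  by apply: eq_bigr => k _; ring.
by rewrite !F.
Qed.

(** The edge joining [u] and [w] may supply one unit, so a degree of at least [K.+2] forces the
    binomial part beyond [K], where masses are at most [r]. For each value at [w], the value at [u]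
    lies in a window of length [a]. *)
Lemma prob_close_degrees (u w : 'I_n) (K a : nat) (r : R) : u != w -> 0 <= r ->
  (forall j, (K < j)%N -> b j <= r) ->
  Ex p V (fun E => [&& K.+2 <= degree E u, K.+2 <= degree E w,
    degree E w <= degree E u & degree E u < degree E w + a]%N%:R) <=
  B K.+1 * (a%:R * r).
Proof.
move=> uw r0 br.
rewrite (Ex_degree2 (fun j k => [&& K.+2 <= j, K.+2 <= k, k <= j & j < k + a]%N%:R) uw).
have F (c : nat) : (c <= 1)%N ->
    \sum_(j < (n - 2).+1) \sum_(k < (n - 2).+1) b j * b k *
     [&& K.+2 <= c + j, K.+2 <= c + k, c + k <= c + j & c + j < c + k + a]%N%:R
     <= B K.+1 * (a%:R * r).
  move=> c1; rewrite exchange_big -btail_sum mulr_suml /=. apply: ler_sum => k _.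
  case: (leqP K.+1 k) => Kk; last first.
    rewrite mulr0 mul0r big1 // => j _.
    have -> : (K.+2 <= c + k)%N = false by lia.
    by rewrite andbF mulr0.
  rewrite mulr1; apply: le_trans (_ : b k * \sum_(j < (n - 2).+1 | (k <= j < k + a)%N) r <= _).
    rewrite [X in _ <= _ * X]big_mkcond mulr_sumr; apply: ler_sum => j _.
    case: ifP => kja.
      rewrite [b j * b k]mulrC -mulrA ler_wpM2l ?bpmf_ge0 //.
      by case: [&& _, _, _ & _]; rewrite ?mulr1 ?mulr0 // br; lia.
    have -> : (c + k <= c + j)%N && (c + j < c + k + a)%N = false by lia.
    by rewrite !andbF !mulr0.
  rewrite ler_wpM2l ?bpmf_ge0 //.
  have := ler_wpM2r r0 (sum_window R (n - 2).+1 k a).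
  by rewrite mulr_suml; under eq_bigr do rewrite mul1r.
case/andP: p01 => p0 p1; have q0 : 0 <= 1 - p by rewrite subr_ge0.
have := ler_wpM2l p0 (F 1%N isT); have := ler_wpM2l q0 (F 0%N isT).
by lra.
Qed.

(** * Second moment of the number of large degrees *)

Section SecondMoment.
Variables (K : nat) (r : R).
Hypotheses (n2 : (2 <= n)%N) (r0 : 0 <= r) (br : forall j, (K < j)%N -> b j <= r).

Let mu := p * B K.+1 + (1 - p) * B K.+2.

Let other (u : 'I_n) : exists w, u != w.
Proof.
case: n n2 u => [|[|l]] // _ u; case: (eqVneq u ord0) => [->|]; last by exists ord0.
by exists (inord 1); rewrite -val_eqE /= inordK.
Qed.

Lemma prob_degree (u : 'I_n) : Ex p V (fun E => (K.+2 <= degree E u)%N%:R) = mu.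
Proof.
have [w uw] := other u.
rewrite (Ex_degree (fun j => (K.+2 <= j)%N%:R) uw) /mu -!btail_sum.
by under eq_bigr do rewrite ltnS.
Qed.

(* The degrees of u and w are independent given whether u and w are joined, so
   the covariance is p (1 - p) b(K + 1)^2. *)
Lemma covariance_degree (u w : 'I_n) : u != w ->
  Ex p V (fun E => ((K.+2 <= degree E u)%N%:R - mu) * ((K.+2 <= degree E w)%N%:R - mu))
  <= r ^+ 2.
Proof.
move=> uw.
rewrite (Ex_degree2 (fun j k => ((K.+2 <= j)%N%:R - mu) * ((K.+2 <= k)%N%:R - mu)) uw).
have F c : \sum_(j < (n - 2).+1) \sum_(k < (n - 2).+1) b j * b k *
    (((K.+2 <= c + j)%N%:R - mu) * ((K.+2 <= c + k)%N%:R - mu)) =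
    ((\sum_(j < (n - 2).+1) b j * (K.+2 <= c + j)%N%:R) - mu) ^+ 2.
  have -> : (\sum_(j < (n - 2).+1) b j * (K.+2 <= c + j)%N%:R) - mu =
      \sum_(j < (n - 2).+1) b j * ((K.+2 <= c + j)%N%:R - mu).
    rewrite -[X in _ - X]mul1r -(bpmf_sum1 p (n - 2)) mulr_suml -sumrB.
    by apply: eq_bigr => j _; ring.
  rewrite expr2 mulr_suml; apply: eq_bigr => j _.
  rewrite mulr_sumr; apply: eq_bigr => k _; ring.
rewrite !F (eq_bigr (fun j : 'I_(n - 2).+1 => b j * (K.+1 <= j)%N%:R)) => [|j _]; last first.
  by rewrite add1n ltnS.
rewrite !btail_sum /mu [B K.+1]btailE.
have := br (ltnSn K); have := bpmf_ge0 (n - 2) p01 K.+1.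
move: (b K.+1) (B K.+2) => x y x0 xr; case/andP: p01 => p0 p1.
have -> : p * (x + y - (p * (x + y) + (1 - p) * y)) ^+ 2 +
   (1 - p) * (y - (p * (x + y) + (1 - p) * y)) ^+ 2 = p * (1 - p) * x ^+ 2 by ring.
apply: le_trans (_ : 1 * x ^+ 2 <= _).
  by rewrite ler_wpM2r ?sqr_ge0 //; nra.
by rewrite mul1r lerXn2r ?nnegrE.
Qed.

Lemma variance_degree (u : 'I_n) :
  Ex p V (fun E => ((K.+2 <= degree E u)%N%:R - mu) ^+ 2) <= mu.
Proof.
apply: (@le_trans _ _ (Ex p V (fun E => (1 - 2 * mu) * (K.+2 <= degree E u)%N%:R + mu ^+ 2))).
  apply: Ex_le => // E _; case: (K.+2 <= _)%N => /=;
    rewrite le_eqVlt; apply/orP; left; apply/eqP; ring.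
rewrite ExD ExZ Ex_cst prob_degree.
have : 0 <= mu ^+ 2 by apply: sqr_ge0.
by nra.
Qed.

(** Chebyshev: the centred count [Z] is at most minus half the mean on this event, and its second
    moment is a sum of n variances and fewer than n^2 covariances. *)
Lemma prob_few_large_degrees (k : nat) : 0 < mu -> k%:R <= n%:R * mu / 2 ->
  Ex p V (fun E => (#|[set u | (K.+2 <= degree E u)%N]| < k)%N%:R) <=
  4 * (n%:R * mu + (n%:R * r) ^+ 2) / (n%:R * mu) ^+ 2.
Proof.
move=> mu0 kM; have n0 : 0 < n%:R :> R by rewrite ltr0n; lia.
have M0 : 0 < n%:R * mu by apply: mulr_gt0.
pose Z (E : {set {set 'I_n}}) : R := \sum_u ((K.+2 <= degree E u)%N%:R - mu).
have ZE E : Z E = #|[set u | (K.+2 <= degree E u)%N]|%:R - n%:R * mu.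
  rewrite /Z sumrB sumr_const card_ord -[mu *+ n]mulr_natl; congr (_ - _).
  rewrite -sum1_card natr_sum [RHS]big_mkcond; apply: eq_bigr => u _.
  by rewrite inE; case: ifP.
have ZZ : Ex p V (fun E => Z E ^+ 2) <= n%:R * mu + (n%:R * r) ^+ 2.
  under eq_Ex => E _.
    rewrite /Z expr2 mulr_suml.
    under eq_bigr do rewrite mulr_sumr.
    over.
  rewrite Ex_sum; under eq_bigr do rewrite Ex_sum.
  apply: le_trans (_ : \sum_(u < n) (mu + \sum_(w < n) r ^+ 2) <= _); last first.
    rewrite sumr_const card_ord -[leLHS]mulr_natl sumr_const card_ord.
    by rewrite -[r ^+ 2 *+ n]mulr_natl mulrDr exprMn mulrA -expr2.
  apply: ler_sum => u _; rewrite (bigD1 u) //=; apply: lerD.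
    by have := variance_degree u; under eq_Ex do rewrite expr2.
  rewrite [leLHS]big_mkcond; apply: ler_sum => w _; case: ifP => uw; last exact: sqr_ge0.
  by apply: covariance_degree; rewrite eq_sym.
apply: le_trans (_ : Ex p V (fun E => 4 / (n%:R * mu) ^+ 2 * Z E ^+ 2) <= _).
  apply: Ex_le => // E _; case: ltnP => Nk; last first.
    by rewrite mulr_ge0 ?sqr_ge0 // divr_ge0 ?sqr_ge0.
  have : Z E <= - (n%:R * mu / 2).
    by rewrite ZE; move: Nk; rewrite -(ltr_nat R); lra.
  move: (Z E) => z zM; rewrite mulrAC ler_pdivlMr ?exprn_gt0 // mul1r.
  by nra.
by rewrite ExZ [leRHS]mulrAC ler_wpM2l // divr_ge0 ?sqr_ge0.
Qed.

End SecondMoment.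
End DegreeLaw.

(** * Signatures *)

(** The generating function at 1/2 of the number of points of [A] where [X] and [Y] differ: a point
    differs with probability 2p(1 - p), so its factor averages to 1 - p(1 - p). *)
Lemma Ex_half_diff (R : realFieldType) (T : finType) (p : R) (W A : {set T}) :
  A \subset W ->
  Ex p W (fun X => Ex p W (fun Y =>
    \prod_(x in A) (if (x \in X) != (x \in Y) then 1 / 2 else 1))) =
  (1 - p * (1 - p)) ^+ #|A|.
Proof.
move=> sAW.
have restrict (F : T -> R) :
    \prod_(x in A) F x = \prod_(x in W) (if x \in A then F x else 1).
  rewrite -big_mkcondr; apply: eq_bigl => x /=.
  by rewrite andbC andb_idr //; apply: (subsetP sAW).
pose G (c c' : bool) : R := if c != c' then 1 / 2 else 1.
under eq_Ex => X _.
  under eq_Ex do rewrite restrict.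
  rewrite (Ex_prod p W (fun x c => if x \in A then G (x \in X) c else 1)); over.
rewrite (Ex_prod p W (fun x c => p * (if x \in A then G c true else 1) +
   (1 - p) * (if x \in A then G c false else 1))).
rewrite -prodr_const restrict; apply: eq_bigr => x _.
by case: ifP => _; rewrite /G /=; field.
Qed.

Section Signatures.
Variables (R : realFieldType) (p : R) (n : nat).
Hypothesis p01 : 0 <= p <= 1.

Definition diff_nbrs (E : {set {set 'I_n}}) (u w : 'I_n) (A : {set 'I_n}) :=
  [set x in A | adj E u x != adj E w x].

(** The set [A] is fixed once the edges avoiding [u] and [w] are exposed; Markov's inequality for
    2^(-D), with D the number of differing adjacencies, then gives the bound. *)
Lemma prob_similar_nbrs (u w : 'I_n) (A : {set {set 'I_n}} -> {set 'I_n}) (s r : nat) :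
  u != w -> (forall E, A E \subset ~: [set u; w]) ->
  (forall (E : {set {set 'I_n}}) b (X Y : {set 'I_n}),
     E \subset pairs_off u w -> X \subset ~: [set u; w] ->
     Y \subset ~: [set u; w] -> A (glue u w E b X Y) = A E) ->
  Ex p (vertex_pairs n)
    (fun E => ((s <= #|A E|) && (#|diff_nbrs E u w (A E)| <= r))%N%:R) <=
  2 ^+ r * (1 - p * (1 - p)) ^+ s.
Proof.
move=> uw sA glueA; case/andP: (p01) => p0 p1.
have pq0 : 0 <= 1 - p * (1 - p) by nra.
have pq1 : 1 - p * (1 - p) <= 1 by nra.
rewrite (Ex_pair uw) -[leRHS](Ex_cst p (pairs_off u w)).
apply: Ex_le => // E sE.
suff F c : Ex p (~: [set u; w]) (fun X => Ex p (~: [set u; w]) (fun Y =>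
     ((s <= #|A (glue u w E c X Y)|) &&
      (#|diff_nbrs (glue u w E c X Y) u w (A (glue u w E c X Y))| <= r))%N%:R)) <=
     2 ^+ r * (1 - p * (1 - p)) ^+ s.
  by have := F true; have := F false; nra.
case: (leqP s #|A E|) => sAE; last first.
  apply: le_trans (_ : 0 <= _); last by rewrite mulr_ge0 ?exprn_ge0.
  rewrite -(Ex_cst p (~: [set u; w]) 0); apply: Ex_le => // X sX.
  rewrite -(Ex_cst p (~: [set u; w]) 0); apply: Ex_le => // Y sY.
  by rewrite glueA // leqNgt sAE.
apply: le_trans (_ : 2 ^+ r * (1 - p * (1 - p)) ^+ #|A E| <= _); last first.
  by rewrite ler_wpM2l ?exprn_ge0 // ler_wiXn2l.
rewrite -(Ex_half_diff p (sA E)) -ExZ; apply: Ex_le => // X sX.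
rewrite -ExZ; apply: Ex_le => // Y sY.
rewrite glueA // sAE /=.
have -> : \prod_(x in A E) (if (x \in X) != (x \in Y) then 1 / 2 else 1) =
    (1 / 2 : R) ^+ #|diff_nbrs (glue u w E c X Y) u w (A E)|.
  rewrite -prodr_const -big_mkcondr; apply: eq_bigl => x; rewrite inE.
  apply: andb_id2l => /(subsetP (sA E)) xW.
  by rewrite (adj_gluel uw) // (adj_gluer uw).
case: leqP => /= dr; last by rewrite mulr_ge0 ?exprn_ge0 // divr_ge0.
rewrite -(subnK dr) exprD -mulrA -exprMn mulrC.
have -> : 2 * (1 / 2) = 1 :> R by field.
by rewrite expr1n mul1r exprn_ege1 // ler1n.
Qed.

End Signatures.

Definition off_degree n (E : {set {set 'I_n}}) (u w x : 'I_n) : nat :=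
  #|[set y in ~: [set u; w] | adj E x y]|.

(* Deleting u and w lowers each degree by at most 2, so when the k largest degrees
   have gaps at least 3 and u, w are not among them, this set consists of the
   k - 1 vertices of largest degree. *)
Definition top_off n (k : nat) (E : {set {set 'I_n}}) (u w : 'I_n) : {set 'I_n} :=
  [set x in ~: [set u; w] |
    (#|[set y in ~: [set u; w] | (off_degree E u w x <= off_degree E u w y)%N]| < k)%N].

(** The invariance under the edges at [u] and [w] that [prob_similar_nbrs] requires of its set. *)
Lemma top_off_glue n k (u w : 'I_n) (E : {set {set 'I_n}}) b (X Y : {set 'I_n}) :
  u != w -> E \subset pairs_off u w ->
  X \subset ~: [set u; w] -> Y \subset ~: [set u; w] ->
  top_off k (glue u w E b X Y) u w = top_off k E u w.
Proof.
move=> uw sE sX sY.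
have oE x : x \in ~: [set u; w] ->
    off_degree (glue u w E b X Y) u w x = off_degree E u w x.
  move=> xW; apply: eq_card => y; rewrite inE [RHS]inE.
  by apply: andb_id2l => yW; rewrite (@adj_glueW _ u w).
apply/setP => x; rewrite inE [RHS]inE; apply: andb_id2l => xW.
congr (_ < _)%N; apply: eq_card => y; rewrite inE [RHS]inE.
by apply: andb_id2l => yW; rewrite !oE.
Qed.

Lemma off_degree_bounds n (E : {set {set 'I_n}}) (u w x : 'I_n) :
  (off_degree E u w x <= degree E x <= (off_degree E u w x).+2)%N.
Proof.
have oE : off_degree E u w x = #|[set y | adj E x y] :\: [set u; w]|.
  by apply: eq_card => y; rewrite !inE.
rewrite oE cardsD /degree leq_subr /=.
have := subset_leq_card (subsetIr [set y | adj E x y] [set u; w]).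
have := cards2 u w; case: (u != w) => /=; lia.
Qed.

Lemma hamming_sig n (E : {set {set 'I_n}}) (v : 'S_n) (h : nat) (u w : 'I_n)
    (A : {set 'I_n}) :
  (forall x, x \in A -> exists2 i : 'I_n, (i < h)%N & x = v i) ->
  (#|diff_nbrs E u w A| <= hamming (sig E v h u) (sig E v h w))%N.
Proof.
move=> Av; rewrite /hamming /sig.
have zipE (s : seq 'I_n) (f g : 'I_n -> bool) :
    zip [seq f i | i <- s] [seq g i | i <- s] = [seq (f i, g i) | i <- s].
  by elim: s => //= i s ->.
rewrite zipE count_map -size_filter.
set s := filter _ _.
(* The differing positions, mapped by [v], cover the differing vertices of [A]. *)
apply: leq_trans (card_size s); apply: leq_trans (leq_imset_card v _).
apply/subset_leq_card/subsetP => x; rewrite inE => /andP[/Av[i ih ->] dx].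
apply/imsetP; exists i => //; rewrite mem_filter /= dx in_take ?mem_enum //.
by rewrite index_enum_ord.
Qed.

(** * A deterministic criterion for separation *)

Lemma card_ord_lt (n j : nat) : (j <= n)%N -> #|[set c : 'I_n | (c < j)%N]| = j.
Proof.
move=> jn; rewrite -sum1_card (eq_bigl (fun c : 'I_n => (c < j)%N)).
  by rewrite (big_ord_narrow jn) sum1_card card_ord.
by move=> c; rewrite inE.
Qed.

(** Reduces separation to conditions whose failures can be estimated one by one. The set [top_off]
    replaces the signature vertices, whose ranks depend on the edges at [u] and [w]. *)
Lemma hab_separatedP n (E : {set {set 'I_n}}) (k K d : nat) : (2 <= d)%N ->
  (k <= #|[set u | (K <= degree E u)%N]|)%N ->
  (forall u w, u != w -> ~~ [&& K <= degree E u, K <= degree E w,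
     degree E w <= degree E u & degree E u < degree E w + (d + 1)]%N) ->
  (forall u w, u != w -> ~~ ((k.-1 <= #|top_off k E u w|) &&
     (#|diff_nbrs E u w (top_off k E u w)| <= 2 * d))%N) ->
  hab_separated k (d + 1) (2 * d + 1) E.
Proof.
move=> d2 kE sep ham; apply/forallP => v; apply/implyP => /forallP sorted.
have {}sorted (i j : 'I_n) : (i <= j)%N -> (degree E (v j) <= degree E (v i))%N.
  by move=> ij; have /forallP/(_ j)/implyP := sorted i; apply.
(* If rank [j] had degree below [K], all vertices of degree at least [K] would have rank below [j],
   and there would be fewer than [k] of them. *)
have large (j : 'I_n) : (j < k)%N -> (K <= degree E (v j))%N.
  move=> jk; rewrite leqNgt; apply/negP => jK; move: (leq_trans jk kE).
  rewrite ltnNge => /negP; apply.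
  apply: leq_trans (_ : #|v @: [set i : 'I_n | (i < j)%N]| <= _)%N.
    apply/subset_leq_card/subsetP => x; rewrite inE => Kx.
    apply/imsetP; exists (v^-1 x)%g; last by rewrite permKV.
    rewrite inE ltnNge; apply/negP => /sorted; rewrite permKV => xj.
    by have := leq_trans Kx xj; rewrite leqNgt jK.
  by rewrite (card_imset _ perm_inj) card_ord_lt // ltnW.
have gap (i j : 'I_n) : (i < j)%N -> (j < k)%N ->
    (degree E (v j) + (d + 1) <= degree E (v i))%N.
  move=> ij jk; have /sep : v i != v j.
    by rewrite (inj_eq perm_inj) -val_eqE /= neq_ltn ij.
  rewrite !large ?(ltn_trans ij jk) // sorted ?(ltnW ij) //= -leqNgt //.
apply/andP; split.
  apply/forallP => i; apply/forallP => j; apply/implyP => /andP[/eqP ji jk].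
  by apply: gap => //; rewrite ji.
apply/forallP => i; apply/forallP => j; apply/implyP => /and3P[ij ki kj].
set u := v i; set w := v j.
have uw : u != w by rewrite (inj_eq perm_inj).
have kn : (k <= n)%N by apply: ltnW; apply: leq_ltn_trans (ltn_ord i).
have inW (l : 'I_n) : (l < k)%N -> v l \in ~: [set u; w].
  move=> lk; rewrite !inE negb_or !(inj_eq perm_inj) -!val_eqE /=; lia.
(* A gap of d + 1 >= 3 survives a loss of at most 2. Only for [l.+1 < k] is the gap below rank [l]
   known, so k - 1 vertices can be recognised and not k. *)
have gap_off (l m : 'I_n) : (l < m)%N -> (l.+1 < k)%N ->
    (off_degree E u w (v m) < off_degree E u w (v l))%N.
  move=> lm lk; have l1 : (l.+1 < n)%N by apply: leq_ltn_trans (ltn_ord m).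
  have := gap l (Ordinal l1) (ltnSn l) lk.
  have := sorted (Ordinal l1) m lm.
  have := off_degree_bounds E u w (v m); have := off_degree_bounds E u w (v l).
  lia.
have topP (l : 'I_n) : (v l \in top_off k E u w) = (l.+1 < k)%N.
  rewrite inE; apply/andP/idP => [[lW]|lk].
    rewrite ltnNge; apply: contraNT; rewrite -leqNgt => kl.
    have [->|k0] := posnP k; first by [].
    (* For l >= k - 1, the ranks below k - 1 together with [l] give k vertices whose reduced degree
       is at least that of [v l]. *)
    apply: leq_trans (_ : #|v @: (l |: [set c : 'I_n | (c < k.-1)%N])| <= _)%N.
      rewrite (card_imset _ perm_inj) cardsU1 inE -leqNgt card_ord_lt; last by lia.
      by rewrite (_ : k.-1 <= l)%N; lia.
    apply/subset_leq_card/subsetP => x /imsetP[c cl ->]; case/setU1P: cl => [->|].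
      by rewrite inE lW leqnn.
    rewrite inE => ck; rewrite inE inW /=; last by lia.
    by apply/ltnW/gap_off => //=; lia.
  rewrite inW ?(ltnW lk) //; split => //.
  apply: (leq_ltn_trans _ lk); apply: leq_trans (_ : #|v @: [set c : 'I_n | (c < l.+1)%N]| <= _)%N.
    apply/subset_leq_card/subsetP => x; rewrite inE => /andP[_ lx].
    apply/imsetP; exists (v^-1 x)%g; last by rewrite permKV.
    rewrite inE ltnS leqNgt; apply/negP => lm.
    by have := gap_off _ _ lm lk; rewrite permKV ltnNge lx.
  by rewrite (card_imset _ perm_inj) card_ord_lt //; apply: ltnW (ltn_ord _).
have top_card : (k.-1 <= #|top_off k E u w|)%N.
  apply: leq_trans (_ : #|v @: [set c : 'I_n | (c < k.-1)%N]| <= _)%N.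
    by rewrite (card_imset _ perm_inj) card_ord_lt //; lia.
  apply/subset_leq_card/subsetP => x /imsetP[c]; rewrite inE => ck ->.
  by rewrite topP; lia.
have := ham u w uw; rewrite top_card /= -ltnNge addn1 => h1; apply: leq_trans h1 _.
apply: hamming_sig => x; rewrite -{1}[x](permKV v) topP => xk.
by exists (v^-1 x)%g; rewrite ?permKV //; apply: ltnW.
Qed.

(** * Union bound over the failure events *)

Lemma Gnp_probE (R : realFieldType) (n : nat) (p : R) (A : pred {set {set 'I_n}}) :
  Gnp_prob p A = Ex p (vertex_pairs n) (fun E => (A E)%:R).
Proof.
rewrite /Gnp_prob big_mkcondr; apply: eq_bigr => E _.
by case: (A E); rewrite ?mulr1 ?mulr0.
Qed.

(** The error terms account, in order, for too few vertices of large degree, two large degrees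
    within d of each other, and two vertices with nearly equal adjacencies to the top vertices. *)
Lemma prob_separated_ge (R : realFieldType) (p r : R) (n k K d : nat) :
  let mu := p * btail p (n - 2) K.+1 + (1 - p) * btail p (n - 2) K.+2 in
  0 <= p <= 1 -> (2 <= n)%N -> (2 <= d)%N -> 0 <= r ->
  (forall j, (K < j)%N -> bpmf p (n - 2) j <= r) ->
  0 < mu -> k%:R <= n%:R * mu / 2 ->
  1 - (4 * (n%:R * mu + (n%:R * r) ^+ 2) / (n%:R * mu) ^+ 2 +
       n%:R ^+ 2 * (btail p (n - 2) K.+1 * ((d + 1)%:R * r)) +
       n%:R ^+ 2 * (2 ^+ (2 * d) * (1 - p * (1 - p)) ^+ k.-1))
  <= Gnp_prob p (@hab_separated n k (d + 1) (2 * d + 1)).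
Proof.
move=> mu p01 n2 d2 r0 br mu0 kmu; rewrite Gnp_probE.
pose few (E : {set {set 'I_n}}) := (#|[set u | (K.+2 <= degree E u)%N]| < k)%N.
pose close (E : {set {set 'I_n}}) (u w : 'I_n) := [&& K.+2 <= degree E u, K.+2 <= degree E w,
  degree E w <= degree E u & degree E u < degree E w + (d + 1)]%N.
pose similar (E : {set {set 'I_n}}) (u w : 'I_n) :=
  ((k.-1 <= #|top_off k E u w|) && (#|diff_nbrs E u w (top_off k E u w)| <= 2 * d))%N.
have sum_le (F : 'I_n -> 'I_n -> R) c : 0 <= c -> (forall u w, u != w -> F u w <= c) ->
    \sum_u \sum_(w | u != w) F u w <= n%:R ^+ 2 * c.
  move=> c0 Fc; apply: le_trans (_ : \sum_(u < n) \sum_(w < n) c <= _); last first.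
    by rewrite !sumr_const !card_ord -mulrnA -[leLHS]mulr_natl natrM -expr2.
  apply: ler_sum => u _; rewrite big_mkcond; apply: ler_sum => w _.
  by case: ifP => // /Fc.
rewrite lerBlDr -{1}(Ex_cst p (vertex_pairs n) 1).
apply: le_trans (_ : Ex p (vertex_pairs n) (fun E =>
   (hab_separated k (d + 1) (2 * d + 1) E)%:R + ((few E)%:R +
   \sum_u \sum_(w | u != w) (close E u w)%:R +
   \sum_u \sum_(w | u != w) (similar E u w)%:R)) <= _).
  apply: Ex_le => // E _.
  have s1 : 0 <= \sum_u \sum_(w | u != w) (close E u w)%:R :> R.
    by apply: sumr_ge0 => u _; apply: sumr_ge0.
  have s2 : 0 <= \sum_u \sum_(w | u != w) (similar E u w)%:R :> R.
    by apply: sumr_ge0 => u _; apply: sumr_ge0.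
  have pos (F : 'I_n -> 'I_n -> bool) u w : u != w -> F u w ->
      1 <= \sum_u \sum_(w | u != w) (F u w)%:R :> R.
    move=> uw Fuw; rewrite (bigD1 u) //= (bigD1 w) //= Fuw -addrA ler_wpDr //.
    by rewrite addr_ge0 ?sumr_ge0 // => v _; rewrite sumr_ge0.
  case: (boolP (hab_separated _ _ _ E)) => /= sepE; first by rewrite lerDl !addr_ge0.
  rewrite add0r; case: (boolP (few E)) => [_|fewE] /=.
    by rewrite -addrA lerDl addr_ge0.
  rewrite add0r; case: (boolP [exists u, exists w, (u != w) && close E u w]).
    move=> /existsP[u /existsP[w /andP[uw cE]]].
    by rewrite ler_wpDr // (pos _ _ _ uw cE).
  move=> ncl; case: (boolP [exists u, exists w, (u != w) && similar E u w]).
    move=> /existsP[u /existsP[w /andP[uw cE]]].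
    by rewrite ler_wpDl // (pos _ _ _ uw cE).
  move=> nsi; case/negP: sepE; apply: (@hab_separatedP _ _ _ K.+2) => //.
  - by rewrite leqNgt.
  - move=> u w uw; apply/negP => cE; case/negP: ncl.
    by apply/existsP; exists u; apply/existsP; exists w; rewrite uw.
  - move=> u w uw; apply/negP => cE; case/negP: nsi.
    by apply/existsP; exists u; apply/existsP; exists w; rewrite uw.
rewrite ExD lerD2l !ExD !Ex_sum; apply: lerD; first apply: lerD.
- exact: (prob_few_large_degrees p01).
- under eq_bigr do rewrite Ex_sum.
  apply: sum_le; first by rewrite !mulr_ge0 ?btail_ge0.
  by move=> u w uw; apply: (prob_close_degrees p01).
under eq_bigr do rewrite Ex_sum.
case/andP: (p01) => p0 p1.
apply: sum_le; first by rewrite mulr_ge0 ?exprn_ge0 //; nra.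
move=> u w uw; apply: (prob_similar_nbrs p01 k.-1 (2 * d) uw (A := fun E => top_off k E u w)).
  by move=> E; apply/subsetP => x; rewrite inE => /andP[].
by move=> E b X Y sE sX sY; apply: top_off_glue.
Qed.

From mathcomp Require Import all_classical all_reals all_analysis.
Import Order.TTheory GRing.Theory Num.Theory.
Import numFieldNormedType.Exports.

(** * Binomial tails *)

Section BinomialTail.
Variables (R : realType) (p : R) (m : nat).
Hypothesis p01 : 0 < p < 1.
Local Notation b := (bpmf p m).

Let p01' : 0 <= p <= 1.
Proof. by case/andP: p01 => p0 p1; rewrite !ltW. Qed.

(** Free of division and with m - k taken in [R], so that it holds for every k: both sides vanish
    when k >= m. *)
Lemma bpmf_ratio k : k.+1%:R * (1 - p) * b k.+1 = (m%:R - k%:R) * p * b k.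
Proof.
rewrite /bpmf; case: (ltnP k m) => km; last first.
  rewrite [in LHS]bin_small ?ltnS // mulr0n !mul0r mulr0.
  move: km; rewrite leq_eqVlt => /orP[/eqP ->|km]; first by rewrite subrr !mul0r.
  by rewrite bin_small // mulr0n !mul0r mulr0.
have -> : (m - k = (m - k.+1).+1)%N by lia.
have := congr1 (fun x => x%:R : R) (mul_bin_left m k).
rewrite !natrM natrB ?(ltnW km) // => e.
rewrite !exprS.
transitivity (k.+1%:R * 'C(m, k.+1)%:R * ((1 - p) * (p * p ^+ k) * (1 - p) ^+ (m - k.+1))).
  by ring.
by rewrite e; ring.
Qed.

(** The maximum is at least the average 1 / (m + 1), and comparing it with the next mass through
    [bpmf_ratio] places the maximiser relative to the mean. *)
Lemma bpmf_mode : exists k, [/\ (k <= m)%N, m.+1%:R^-1 <= b k & m%:R * p <= k.+1%:R].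
Proof.
pose k := [arg max_(i > (ord0 : 'I_m.+1)) b i]%O.
have kP (i : 'I_m.+1) : b i <= b k.
  by rewrite /k; case: Order.TotalTheory.arg_maxP => // j _; apply.
have bk : m.+1%:R^-1 <= b k.
  rewrite -[leLHS]mul1r ler_pdivrMr ?ltr0Sn // -[leLHS](bpmf_sum1 p m).
  apply: le_trans (ler_sum _ (fun i _ => kP i)) _.
  by rewrite sumr_const card_ord mulr_natr.
exists k; split => //; first by rewrite -ltnS.
have bk0 : 0 < b k by apply: lt_le_trans bk; rewrite invr_gt0 ltr0Sn.
have bk1 : b k.+1 <= b k.
  case: (ltnP k m) => km; first exact: (kP (Ordinal (km : (k.+1 < m.+1)%N))).
  by rewrite {1}/bpmf bin_small // mulr0n !mul0r ltW.
case/andP: p01 => p0 p1.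
have : (m%:R - k%:R) * p <= k.+1%:R * (1 - p).
  rewrite -(ler_pM2r bk0) -bpmf_ratio ler_wpM2l // mulr_ge0 // subr_ge0 ltW //.
by rewrite -!natr1; nra.
Qed.

(** Past the mean, the step from j to j + 1 loses a proportion of at most (j + 1 - m p) / ((j + 1)(1
    - p)) <= e; Bernoulli's inequality combines the steps. *)
Lemma bpmf_decay (K t : nat) (e : R) : m%:R * p <= K.+1%:R -> 0 <= e <= 1 ->
  (K + t)%:R - m%:R * p <= e * (m%:R * p * (1 - p)) ->
  forall i, (i <= t)%N -> (1 - i%:R * e) * b K <= b (K + i)%N.
Proof.
case/andP: p01 => p0 p1 mpK /andP[e0 e1] et; elim=> [|i IH] it.
  by rewrite mul0r subr0 mul1r addn0.
have j1 : (K + i).+1%:R - m%:R * p <= e * (m%:R * p * (1 - p)).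
  by apply: le_trans et; rewrite lerD2r ler_nat; lia.
have j2 : m%:R * p <= (K + i).+1%:R :> R.
  by apply: le_trans mpK _; rewrite ler_nat; lia.
have {IH} := IH (ltnW it); rewrite addnS; set j := (K + i)%N in j1 j2 *.
have := bpmf_ratio j; have := bpmf_ge0 m p01' j; have := bpmf_ge0 m p01' K.
move: (b j) (b j.+1) (b K) => x y z z0 x0 xy zx.
have q0 : 0 < 1 - p by rewrite subr_gt0.
have jq : 0 < j.+1%:R * (1 - p) by rewrite mulr_gt0 // ltr0Sn.
have xy1 : (1 - e) * x <= y.
  rewrite -(ler_pM2l jq) xy mulrA ler_wpM2r //.
  have : e * (m%:R * p * (1 - p)) <= e * (j.+1%:R * (1 - p)).
    by rewrite ler_wpM2l // ler_wpM2r // ltW.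
  by move: j1 j2; rewrite -natr1; nra.
apply: le_trans xy1; apply: le_trans (_ : (1 - e) * ((1 - i%:R * e) * z) <= _); last first.
  by rewrite ler_wpM2l // subr_ge0.
rewrite mulrA ler_wpM2r // -natr1.
have : 0 <= i%:R * (e * e) by rewrite mulr_ge0 // mulr_ge0.
by nra.
Qed.

Lemma btail_ge_sum k t : \sum_(i < t) b (k + i)%N <= btail p m k.
Proof.
elim: t k => [|t IH] k; first by rewrite big_ord0 btail_ge0.
rewrite big_ord_recl addn0 btailE lerD2l; apply: le_trans (IH k.+1).
by apply: ler_sum => i _; rewrite lift0 addnS addSn.
Qed.

Lemma btail_le_window k T r : 0 <= r -> (forall j, (k <= j)%N -> b j <= r) ->
  btail p m k <= T%:R * r + btail p m (k + T).
Proof.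
move=> r0; elim: T k => [|T IH] k br; first by rewrite mul0r add0r addn0.
rewrite btailE -natr1 mulrDl mul1r [_ + r]addrC -addrA lerD ?br //.
rewrite addnS -addSn; apply: IH => j kj.
by apply: br; apply: ltnW.
Qed.

(** Exponential Markov inequality with exp t <= 1 + t + 2 t^2, which for 0 <= t <= 1/2 follows from
    exp t (1 - t) <= 1. *)
Lemma chernoff_btail (k : nat) (t : R) : 0 <= t <= 1 / 2 ->
  btail p m k <= expR (m%:R * p * (t + 2 * t ^+ 2) - t * k%:R).
Proof.
case/andP: p01 => p0 p1 /andP[t0 t1].
have et : expR t <= 1 + t + 2 * t ^+ 2.
  have h1 : expR t * (1 - t) <= 1.
    rewrite -[leRHS](expRxMexpNx_1 t) ler_wpM2l ?expR_ge0 //.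
    by have := expR_ge1Dx (- t); rewrite addrC.
  have := expR_ge0 t; move: (expR t) h1 => x; nra.
apply: le_trans (_ : \sum_(j < m.+1) b j * expR t ^+ j * expR (- t * k%:R) <= _).
  rewrite -btail_sum; apply: ler_sum => j _; rewrite -mulrA ler_wpM2l ?bpmf_ge0 //.
  rewrite -expRM_natr -expRD mulNr -mulrBr.
  case: leqP => kj /=; last exact: expR_ge0.
  rewrite -[leLHS]addr0; apply: le_trans (expR_ge1Dx _).
  by rewrite lerD2l mulr_ge0 // subr_ge0 ler_nat.
rewrite -mulr_suml bpmf_mgf expRD -mulNr ler_wpM2r ?expR_ge0 //.
rewrite -mulrA expRM_natl; apply: lerXn2r; rewrite ?nnegrE ?expR_ge0 //.
  by rewrite addr_ge0 ?subr_ge0 ?mulr_ge0 ?expR_ge0 // ltW.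
apply: le_trans (expR_ge1Dx _).
by have := ler_wpM2l (ltW p0) et; lra.
Qed.

End BinomialTail.

(** [K] is the last index of mass at least rho / n. The bound rho <= 1 makes the mode such an index,
    and rho > 1 / n keeps [K] below the Chernoff range. *)
Lemma exists_degree_threshold (R : realType) (p s rho : R) (n : nat) :
  let b := bpmf p (n - 2) in let B := btail p (n - 2) in
  0 < p <= 1 / 2 -> (4 <= n)%N -> 1 <= ln n%:R :> R ->
  s ^+ 2 * ln n%:R = p * (1 - p) * n%:R -> 128 <= s -> n%:R^-1 < rho <= 1 ->
  exists K : nat, [/\ forall j, (K < j)%N -> b j <= rho / n%:R,
    n%:R * B K.+1 <= 1 + rho * (6 * s * ln n%:R + 1)
    & s * rho / 128 <= n%:R * B K.+2].
Proof.
move=> b B /andP[p0 p12] n4; set L := ln _; move=> L1 sL s128; set m := (n - 2)%N in b B *.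
case/andP=> rhon rho1.
have p01 : 0 < p < 1 by rewrite p0; lra.
have p01' : 0 <= p <= 1 by case/andP: p01 => *; rewrite !ltW.
have n0 : 0 < n%:R :> R by rewrite ltr0n; clear -n4; lia.
have m_n : m%:R = n%:R - 2 :> R by rewrite /m natrB //; clear -n4; lia.
have m1n : (m.+1 <= n)%N by rewrite /m; clear -n4; lia.
have n4' : 4 <= n%:R :> R by rewrite ler_nat.
have rho0 : 0 < rho by apply: lt_trans rhon; rewrite invr_gt0.
have s0 : 0 < s by lra.
have sL0 : 0 < s * L by rewrite mulr_gt0 //; lra.
pose large := [pred k : nat | (k <= m)%N && (rho / n%:R <= b k)].
have [k0 [k0m bk0 mpk0]] := bpmf_mode m p01.
have {}bk0 : rho / n%:R <= b k0.
  apply: le_trans bk0; rewrite ler_pdivrMr //; apply: le_trans rho1 _.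
  by rewrite mulrC ler_pdivlMr ?ltr0Sn // mul1r ler_nat.
have ex_large : exists k, large k.
  by exists k0; rewrite /= k0m.
have large_le k : large k -> (k <= m)%N by case/andP.
have [K /andP[Km bK] Kmax] := ex_maxnP ex_large large_le.
have mpK : m%:R * p <= K.+1%:R.
  apply: le_trans mpk0 _; rewrite ler_nat ltnS; apply: (Kmax k0).
  by rewrite /= k0m.
have bgt j : (K < j)%N -> b j <= rho / n%:R.
  move=> Kj; case: (leqP j m) => jm; last first.
    by rewrite /b /bpmf bin_small // mulr0n !mul0r divr_ge0 ?ltW.
  rewrite leNgt; apply/negP => bj.
  by have := Kmax j; rewrite /= jm (ltW bj) leqNgt Kj => /(_ isT).
have mp2 : m%:R * p <= 2 * (s ^+ 2 * L).
  rewrite sL m_n; have : 0 <= p * n%:R by rewrite mulr_ge0 ?ltW.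
  by nra.
have tail_small k : m%:R * p + 6 * (s * L) <= k%:R -> B k <= n%:R^-1 * n%:R^-1.
  move=> hk; have lnn : expR L = n%:R by rewrite lnK // posrE.
  (* Chernoff at t = 1 / s: the exponent is at most 2 m p / s^2 - 6 L <= 4 L - 6 L = - 2 L. *)
  have t12 : 0 <= s^-1 <= 1 / 2.
    rewrite invr_ge0 (ltW s0) /= -[leLHS]mul1r ler_pdivrMr //; lra.
  apply: le_trans (chernoff_btail m p01 k t12) _.
  rewrite -lnn -expRN -expRD ler_expR.
  have h1 : s^-1 * (m%:R * p + 6 * (s * L)) <= s^-1 * k%:R.
    by rewrite ler_wpM2l // invr_ge0 ltW.
  have h2 : s^-1 * (6 * (s * L)) = 6 * L by field; rewrite gt_eqF.
  have h3 : m%:R * p * s^-1 ^+ 2 <= 2 * L.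
    have -> : 2 * L = 2 * (s ^+ 2 * L) * s^-1 ^+ 2 by field; rewrite gt_eqF.
    by rewrite ler_wpM2r // exprn_ge0 // invr_ge0 ltW.
  move: h1; rewrite mulrDr h2; move: h3; move: (s^-1) => t.
  by nra.
have KL : K%:R < m%:R * p + 6 * (s * L).
  rewrite ltNge; apply/negP => /tail_small.
  apply/negP; rewrite -ltNge; apply: (@lt_le_trans _ _ (b K)); last first.
    by rewrite /B btailE lerDl btail_ge0.
  by apply: lt_le_trans bK; rewrite ltr_pM2r ?invr_gt0.
exists K; split => //.
(* Upper bound: [T] masses of at most rho / n reach m p + 6 s L, and the rest of the tail is at most
   1 / n^2. *)
- pose T := (Num.truncn (6 * (s * L))).+1.
  have TL : 6 * (s * L) < T%:R by apply: truncnS_gt.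
  have TU : T%:R <= 6 * (s * L) + 1.
    by rewrite -[T%:R]natr1 lerD2r truncn_le // mulr_ge0 // ltW.
  have r0 : 0 <= rho / n%:R by rewrite divr_ge0 ?ltW.
  have := btail_le_window T r0 bgt.
  have /tail_small : m%:R * p + 6 * (s * L) <= (K.+1 + T)%:R.
    by rewrite natrD lerD // ltW.
  rewrite -/B => tl /(fun h => le_trans h (lerD (lexx _) tl)) BK.
  have := ler_wpM2l (ltW n0) BK; move/le_trans; apply.
  rewrite mulrDr addrC lerD //.
    rewrite mulrA mulfV ?gt_eqF // mul1r.
    by rewrite invf_le1 // ler1n; clear -n4; lia.
  have -> : n%:R * (T%:R * (rho / n%:R)) = rho * T%:R by field; rewrite gt_eqF.
  by rewrite ler_wpM2l ?(ltW rho0) // -[6 * s * L]mulrA.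
(* Lower bound: with e = 1 / (2 T), the masses at K + 2, ..., K + T are at least half that at K. The
   choice of [T] gives e >= 16 / s, enough for the decay since K + T exceeds the mean by at most 8 s
   L. *)
pose T := Num.truncn (s / 32).
have s32 : 0 <= s / 32 by lra.
have TL : T%:R <= s / 32 by rewrite truncn_le.
have TU : s / 32 < T%:R + 1 by rewrite natr1 truncnS_gt.
have T4 : 3 < T%:R :> R by lra.
have T0 : (0 < T)%N by rewrite -(ltr_nat R); lra.
pose e : R := (2 * T%:R)^-1.
have e01 : 0 <= e <= 1.
  by rewrite /e invr_ge0 invf_le1; lra.
have eT : e * T%:R = 1 / 2 by rewrite /e; field; rewrite gt_eqF //; lra.
have e16 : 16 / s <= e.
  rewrite /e ler_pdivrMr // mulrC ler_pdivlMr; lra.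
have KT : (K + T)%:R - m%:R * p <= e * (m%:R * p * (1 - p)).
  have h : 16 / s * (s ^+ 2 * L / 2) <= e * (m%:R * p * (1 - p)).
    apply: ler_pM => //; first by rewrite divr_ge0 ?ltW.
      by rewrite divr_ge0 // mulr_ge0 ?sqr_ge0 //; lra.
    rewrite sL m_n; have : 0 <= p * (1 - p) by case/andP: p01' => *; rewrite mulr_ge0 ?subr_ge0.
    by nra.
  have e8 : 16 / s * (s ^+ 2 * L / 2) = 8 * (s * L) by field; rewrite gt_eqF.
  rewrite e8 in h; apply: le_trans h; rewrite natrD.
  have : s <= s * L by rewrite ler_peMr // ltW.
  by lra.
have decay := bpmf_decay p01 mpK e01 KT.
apply: le_trans (_ : n%:R * (T.-1%:R * (1 / 2 * (rho / n%:R))) <= _); last first.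
  rewrite ler_pM2l //; apply: le_trans (btail_ge_sum m p01 K.+2 T.-1).
  rewrite mulr_natl -[X in _ *+ X]card_ord -sumr_const; apply: ler_sum => i _.
  have iT : (i.+2 <= T)%N by case: i => i /=; case: (T) T0.
  rewrite !addSnnS.
  apply: le_trans (decay _ iT); apply: ler_pM => //; first by rewrite divr_ge0 ?ltW.
  rewrite -eT; have : i.+2%:R * e <= T%:R * e.
    by rewrite ler_wpM2r ?ler_nat //; case/andP: e01.
  by lra.
have -> : n%:R * (T.-1%:R * (1 / 2 * (rho / n%:R))) = rho * (T.-1%:R / 2).
  by field; rewrite gt_eqF.
rewrite mulrAC mulrC ler_wpM2l ?ltW //.
have -> : T.-1%:R = T%:R - 1 :> R by rewrite -subn1 natrB.
by lra.
Qed.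

(** * Numerical estimates *)

(** With [M] the expected number of large degrees, the chain is 4 (M + 1) / M^2 <= 8 / M <= 2 / H <=
    delta / 4. *)
Lemma few_degrees_bound (R : realFieldType) (H delta M rho : R) :
  0 < H -> 0 < delta -> 0 <= rho <= 1 -> 1 <= M -> 4 * H <= M -> 8 <= H * delta ->
  4 * (M + rho ^+ 2) / M ^+ 2 <= delta / 4.
Proof.
move=> H0 dl0 /andP[rho0 rho1] M1 HM Hd.
have M0 : 0 < M by apply: lt_le_trans M1.
rewrite ler_pdivrMr ?exprn_gt0 //.
have h1 : 8 * M <= H * delta * M by rewrite ler_pM2r.
have h2 : 4 * H * (delta * M) <= M * (delta * M) by rewrite ler_pM2r // mulr_gt0.
have h3 : rho ^+ 2 <= 1 by rewrite expr_le1.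
by move: h1 h2 h3; rewrite expr2 [M ^+ 2]expr2; lra.
Qed.

Lemma close_degrees_bound (R : realFieldType) (H L delta s rho a B : R) :
  0 < s -> 0 <= a -> 0 <= rho <= 1 -> 1 <= L -> 1 <= H -> 360 ^+ 2 * L <= H ->
  rho * s = 512 * H -> delta * s = 64 * a * H ^+ 3 -> B <= 1 + rho * (6 * s * L + 1) ->
  B * (a * rho) <= delta / 4.
Proof.
move=> s0 a0 /andP[rho0 rho1] L1 H1 HL rhos ds HB.
have y8 : a * rho * H ^+ 2 = 8 * delta.
  have s_neq0 : s != 0 by rewrite gt_eqF.
  apply: (mulIf s_neq0).
  rewrite -[RHS]mulrA ds; transitivity (a * H ^+ 2 * (rho * s)); first by ring.
  by rewrite rhos; ring.
have y0 : 0 <= a * rho by rewrite mulr_ge0.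
apply: le_trans (ler_wpM2r y0 HB) _.
have -> : delta / 4 = H ^+ 2 / 32 * (a * rho).
  by rewrite [RHS]mulrAC [H ^+ 2 * _]mulrC y8; field.
rewrite ler_wpM2r //.
have -> : rho * (6 * s * L + 1) = 6 * L * (rho * s) + rho by ring.
have hl : H * (360 ^+ 2 * L) <= H * H by rewrite ler_wpM2l //; lra.
have : 1 <= H * L by rewrite mulr_ege1.
by move: hl; rewrite rhos !expr2; lra.
Qed.

(** Uses 2 <= e and 1 - x <= exp (- x), with p (1 - p) >= p / 2; H >= 4 makes the truncation of [H],
    minus one, at least H / 2. *)
Lemma similar_nbrs_bound (R : realType) (p H delta : R) (n d : nat) :
  0 < p <= 1 / 2 -> (0 < n)%N -> 4 <= H ->
  expR (2 * ln n%:R + 2 * d%:R - p * H / 4) <= delta / 4 ->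
  n%:R ^+ 2 * (2 ^+ (2 * d) * (1 - p * (1 - p)) ^+ (Num.truncn H).-1) <= delta / 4.
Proof.
move=> /andP[p0 p12] n0 H4; apply: le_trans.
have Hk : H < (Num.truncn H)%:R + 1 by rewrite natr1 truncnS_gt.
have -> : 2 * ln n%:R + 2 * d%:R - p * H / 4 =
    ln n%:R * 2%:R + (1 * (2 * d)%:R + - (p * H / 4)) by rewrite natrM; ring.
rewrite expRD expRM_natr lnK ?posrE ?ltr0n // ler_wpM2l ?exprn_ge0 // expRD.
have pq0 : 0 <= 1 - p * (1 - p) by nra.
rewrite ler_pM ?exprn_ge0 //.
  rewrite expRM_natr lerXn2r ?nnegrE ?expR_ge0 //.
  by have := expR_ge1Dx (1 : R); lra.
apply: le_trans (_ : expR (- (p * (1 - p)) * (Num.truncn H).-1%:R) <= _).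
  rewrite expRM_natr lerXn2r ?nnegrE ?expR_ge0 //.
  by have := expR_ge1Dx (- (p * (1 - p))); lra.
rewrite ler_expR mulNr lerN2.
have : H / 2 <= (Num.truncn H).-1%:R.
  have : (0 < Num.truncn H)%N by rewrite -(ltr_nat R); lra.
  by case: (Num.truncn H) Hk => // k; rewrite -natr1 /=; lra.
move: (_.-1%:R) => k k1.
have : p / 2 * (H / 2) <= p * (1 - p) * k.
  by apply: ler_pM => //; [lra | lra | nra].
by lra.
Qed.

(** From delta < 1 and d >= 2 comes s >= 192 H^3 >= 512 H, and s^2 <= n with s >= 1 gives s <= n. *)
Lemma rho_bounds (R : realFieldType) (p delta H s L n d : R) :
  0 < p <= 1 / 2 -> 0 < delta < 1 -> 2 <= d -> 0 < n -> 1 <= L -> 0 < s ->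
  s ^+ 2 * L = p * (1 - p) * n -> delta * s = 64 * (d + 1) * H ^+ 3 -> 1000 <= H ->
  128 <= s /\ n^-1 < 512 * H / s <= 1.
Proof.
move=> /andP[p0 p12] /andP[dl0 dl1] d2 n0 L1 s0 sL ds H0.
have sH : 192 * H ^+ 3 <= s.
  have H3 : 0 <= H ^+ 3 by rewrite exprn_ge0 //; lra.
  have := ler_wpM2r H3 d2; have := ler_wpM2r (ltW s0) (ltW dl1).
  by move: ds; rewrite mul1r; move: (H ^+ 3) H3 => h; lra.
have HHH : 512 * H <= 192 * H ^+ 3 by rewrite exprSr expr2; nra.
have sn : s <= n.
  have : s ^+ 2 <= s ^+ 2 * L by rewrite ler_peMr // sqr_ge0.
  have : p * (1 - p) * n <= n by rewrite ler_piMl ?(ltW n0) //; nra.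
  have : s * 1 <= s * s by rewrite ler_pM2l //; lra.
  by rewrite sL expr2 mulr1; lra.
split; first by lra.
rewrite ler_pdivrMr // mul1r (le_trans HHH sH) andbT.
by rewrite ltr_pdivlMr // mulrC ltr_pdivrMr //; nra.
Qed.

Lemma prob_separated_delta (R : realType) (p delta H s : R) (n d : nat) :
  0 < p <= 1 / 2 -> 0 < delta < 1 -> (2 <= d)%N -> (4 <= n)%N -> 1 <= ln n%:R :> R ->
  0 < s -> s ^+ 2 * ln n%:R = p * (1 - p) * n%:R ->
  delta * s = 64 * (d%:R + 1) * H ^+ 3 -> 360 ^+ 2 * ln n%:R <= H -> 8 <= H * delta ->
  expR (2 * ln n%:R + 2 * d%:R - p * H / 4) <= delta / 4 ->
  1 - delta <= Gnp_prob p (@hab_separated n (Num.truncn H) (d + 1) (2 * d + 1)).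
Proof.
move=> p012 dl01 d2 n4 L1 s0 sL ds HL Hd hsig.
have /andP[p0 p12] := p012; have /andP[dl0 dl1] := dl01.
have p01 : 0 <= p <= 1 by rewrite ltW //=; lra.
have n2 : (2 <= n)%N by apply: leq_trans n4.
have n0 : 0 < n%:R :> R by rewrite ltr0n; apply: leq_trans n4.
set L := ln n%:R in L1 sL HL hsig *.
have H1000 : 1000 <= H.
  by apply: le_trans HL; rewrite expr2; move: L1; clear; lra.
have H4 : 4 <= H by apply: le_trans H1000; rewrite ler_nat.
have H1 : 1 <= H by apply: le_trans H1000; rewrite ler1n.
have H0 : 0 < H by apply: lt_le_trans H1.
have d2' : 2 <= d%:R :> R by rewrite ler_nat.
(* The factor 512 is 4 times the 128 lost in [exists_degree_threshold], so at least 4 H large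
   degrees are expected. *)
pose rho := 512 * H / s.
have rhos : rho * s = 512 * H by rewrite /rho divfK // gt_eqF.
have [s128 rho_itv] := rho_bounds p012 dl01 d2' n0 L1 s0 sL ds H1000.
have /andP[rhon rho1] := rho_itv.
have rho0 : 0 < 512 * H / s by apply: lt_trans rhon; rewrite invr_gt0.
have [K [bK B1 B2]] := exists_degree_threshold p012 n4 L1 sL s128 rho_itv.
rewrite -/rho in rhon rho1 rho0 bK B1 B2.
set B := btail p (n - 2) in B1 B2.
pose mu := p * B K.+1 + (1 - p) * B K.+2.
have muB : B K.+2 <= mu.
  rewrite /mu mulrBl mul1r addrCA lerDl subr_ge0 ler_wpM2l ?(ltW p0) //.
  exact: btail_le.
have M4 : 4 * H <= n%:R * mu.
  have <- : s * rho / 128 = 4 * H by rewrite [s * _]mulrC rhos; field.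
  by apply: le_trans B2 _; rewrite ler_pM2l.
have mu0 : 0 < mu.
  by rewrite -(pmulr_rgt0 _ n0); apply: lt_le_trans M4; rewrite mulr_gt0.
have M1 : 1 <= n%:R * mu.
  by apply: le_trans M4; move: H1; clear; lra.
have kH : (Num.truncn H)%:R <= H by rewrite truncn_le ltW.
have kmu : (Num.truncn H)%:R <= n%:R * mu / 2.
  by apply: le_trans kH _; move: M4 H0; move: (n%:R * mu) => M; clear; lra.
have r0 : 0 <= rho / n%:R by rewrite divr_ge0 ?ltW.
apply: le_trans (prob_separated_ge p01 n2 d2 r0 bK mu0 kmu).
rewrite -/B -/mu lerD2l lerN2.
have nr : n%:R * (rho / n%:R) = rho by rewrite mulrC divfK // gt_eqF.
have rho01 : 0 <= rho <= 1 by rewrite ltW.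
have T1 : 4 * (n%:R * mu + (n%:R * (rho / n%:R)) ^+ 2) / (n%:R * mu) ^+ 2 <= delta / 4.
  by rewrite nr; apply: (few_degrees_bound H0).
have T2 : n%:R ^+ 2 * (B K.+1 * ((d + 1)%:R * (rho / n%:R))) <= delta / 4.
  have -> : n%:R ^+ 2 * (B K.+1 * ((d + 1)%:R * (rho / n%:R))) =
      n%:R * B K.+1 * ((d%:R + 1) * rho).
    by rewrite natrD; field; rewrite gt_eqF.
  by apply: (@close_degrees_bound _ H L delta s) => //; rewrite addr_ge0.
have T3 := similar_nbrs_bound p012 (ltnW n2) H4 hsig.
apply: le_trans (lerD (lerD T1 T2) T3) _.
by move: dl0; clear; lra.
Qed.

(** * The conditions on p and delta in logarithmic form *)

(** Each variable is a logarithm: [ln] that of n, [lln] that of log n, [ld1] that of d + 1, [lq]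
    that of 1 - p. As p h contains p^(7/6), the exponent 1/7 in the lower bound on p cancels delta
    and n; C^(1/6) absorbs the constants. *)
Lemma log_pH_ge (R : realFieldType) (l2 lC lp lq ld ld1 ln lln ldelta lH : R) :
  0 <= l2 -> lC = 16 * l2 -> 0 <= ld -> ld1 <= ld + l2 -> - l2 <= lq ->
  lH = - (2 * l2) + (ldelta - ld1) / 3 + (lp + lq + ln - lln) / 6 ->
  lC + ld + lln + (2 * ld - (2 * ldelta + ln)) / 7 <= lp ->
  lC + ld + lln <= lp + lH.
Proof. by move=> l2_ge0 -> ld_ge0 ld1_le lq_ge -> lp_ge; lra. Qed.

(** Up to constants, the lower bound on p yields h delta >= delta^(9/7) n^(1/7) d^(-5/42). Since p
    <= 1/2, it also forces d^9 <= delta^2 n / (log n)^7. Together they give delta^(34/27) n^(7/54)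
    (log n)^(5/54). As 34/27 * 7/68 = 7/54, the powers of n balance at beta = 7/68, and the power of
    log n absorbs the constants. *)
Lemma log_Hdelta_ge (R : realFieldType) (l2 lC lc lp lq ld ld1 ln lln ldelta lH : R) :
  0 <= l2 -> lC = 16 * l2 -> 0 <= ld -> ld1 <= ld + l2 -> - l2 <= lq ->
  lH = - (2 * l2) + (ldelta - ld1) / 3 + (lp + lq + ln - lln) / 6 ->
  lC + ld + lln + (2 * ld - (2 * ldelta + ln)) / 7 <= lp ->
  l2 <= 1 -> lp <= - l2 -> lc - 7 / 68 * ln <= ldelta ->
  15 + 14 * `|lc| <= lln -> 3 * l2 <= lH + ldelta.
Proof.
move=> l2_ge0 -> ld_ge0 ld1_le lq_ge -> lp_ge l21 lp_le ldelta_ge.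
have : - `|lc| <= lc by rewrite lerNl; have := ler_norm (- lc); rewrite normrN.
by have := normr_ge0 lc; move: `|lc| => A; lra.
Qed.

(** * Choice of the constants and conclusion *)

Local Open Scope classical_set_scope.

Theorem theorem20 (R : realType) (beta : R) (delta : nat -> R)
  (hbeta : 0 <= beta <= 7 / 68)
  (hdelta_gt0 : \forall n \near \oo, 0 < delta n)
  (hdelta : delta \is 'Theta_\oo (fun n : nat => n%:R `^ (- beta) : R)) :
  exists (C : R) (N : nat), 0 < C /\
    forall d n : nat, (2 <= d)%N -> (N <= n)%N ->
    forall p : R,
      C * d%:R * ln n%:R * (d%:R ^+ 2 / (delta n ^+ 2 * n%:R)) `^ (1 / 7)
        <= p <= 1 / 2 ->
      let h : R := 1 / 4 * (delta n / (d%:R + 1)) `^ (1 / 3)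
                     * (p * (1 - p) * n%:R / ln n%:R) `^ (1 / 6) in
      1 - delta n
        <= Gnp_prob p (@hab_separated n (Num.truncn h) (d + 1) (2 * d + 1)).
Proof.
have := hdelta; rewrite qualifE => /asboolP[[c c'] /= /andP[c0 _] /near_andP[hc _]].
have [N1 _ hN1] := filterI hdelta_gt0 hc.
(* The lower bound on ln (ln n) that [log_Hdelta_ge] needs, enforced by the double exponential in
   [N2]; [c] is the constant in delta n >= c n^(-beta). *)
pose A : R := 15 + 14 * `|ln c|.
pose N2 := (Num.truncn (expR (expR A))).+1.
have [C [C0 lnC C_ge]] : exists C : R, [/\ 0 < C, ln C = 16 * ln 2 & 180 ^+ 2 <= C].
  exists (2 ^+ 16); split; first by rewrite exprn_gt0.
    by rewrite lnXn // mulr_natl.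
  rewrite [X in _ <= X](exprM 2 8 2) lerXn2r ?nnegrE ?exprn_ge0 //.
  by rewrite -natrX ler_nat.
exists C, (maxn 4 (maxn N1 N2)); split=> //.
move=> d n d2 nN p /andP[hp p12] /=; set H := (X in Num.truncn X).
have /and3P[n4 nN1 nN2] : [&& 4 <= n, N1 <= n & N2 <= n]%N by rewrite -!geq_max.
have [dl0 dlc] := hN1 n nN1.
set dl := delta n in hp H dl0 dlc *; set L := ln n%:R in hp H *.
have n0 : 0 < n%:R :> R by rewrite ltr0n; apply: leq_trans n4.
have AL : expR A <= L.
  rewrite -ler_expR lnK ?posrE //; apply: le_trans (ltW (truncnS_gt _)) _.
  by rewrite ler_nat.
have A15 : 15 <= A by rewrite lerDl mulr_ge0.
have L_A : A <= L by apply: le_trans AL; have := expR_ge1Dx A; lra.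
have L0 : 0 < L by lra.
have L1 : 1 <= L by lra.
have lnL : A <= ln L by rewrite -ler_expR lnK ?posrE.
have d0 : 0 < d%:R :> R by rewrite ltr0n; apply: leq_trans d2.
have d2' : 2 <= d%:R :> R by rewrite ler_nat.
pose Y := d%:R ^+ 2 / (dl ^+ 2 * n%:R).
have Y0 : 0 < Y by rewrite divr_gt0 ?mulr_gt0 ?exprn_gt0.
have lower0 : 0 < C * d%:R * L * Y `^ (1 / 7).
  by rewrite !mulr_gt0 ?powR_gt0.
have p0 : 0 < p by apply: lt_le_trans hp.
have q0 : 0 < 1 - p by lra.
(* When delta n >= 1 the claimed lower bound is nonpositive. *)
have [dl1|dl1] := leP 1 dl.
  rewrite Gnp_probE; apply: le_trans (_ : 0 <= _); first by rewrite subr_le0.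
  by apply: Ex_ge0 => //; rewrite ltW //=; lra.
pose X := p * (1 - p) * n%:R / L.
have X0 : 0 < X by rewrite divr_gt0 ?mulr_gt0.
have d1 : 0 < d%:R + 1 :> R by lra.
have Z0 : 0 < dl / (d%:R + 1) by rewrite divr_gt0.
have H0 : 0 < H by rewrite /H !mulr_gt0 ?powR_gt0.
have l2_ge0 : 0 <= ln (2 : R) by rewrite ln_ge0 // ler1n.
have l2_le1 : ln (2 : R) <= 1 by have := @le_ln1Dx R 1; rewrite -natr1; apply; lra.
have lnH : ln H = - (2 * ln 2) + (ln dl - ln (d%:R + 1)) / 3 +
    (ln p + ln (1 - p) + ln n%:R - ln L) / 6.
  rewrite /H !lnM ?posrE ?mulr_gt0 ?powR_gt0 ?invr_gt0 // !ln_powR.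
  rewrite !lnM ?posrE ?mulr_gt0 ?invr_gt0 // !lnV ?posrE // ln1.
  by rewrite (_ : 4 = 2 ^+ 2 :> R) ?lnXn //; [field|ring].
have lnp : ln C + ln d%:R + ln L +
    (2 * ln d%:R - (2 * ln dl + ln n%:R)) / 7 <= ln p.
  apply: le_trans (_ : ln (C * d%:R * L * Y `^ (1 / 7)) <= _); last first.
    by rewrite ler_ln ?posrE.
  rewrite !lnM ?posrE ?mulr_gt0 ?powR_gt0 // ln_powR /Y.
  rewrite lnM ?posrE ?invr_gt0 ?mulr_gt0 ?exprn_gt0 // lnV ?posrE ?mulr_gt0 ?exprn_gt0 //.
  rewrite lnM ?posrE ?exprn_gt0 // !(@lnXn _ 2) //; lra.
have lnd1 : ln (d%:R + 1) <= ln d%:R + ln 2 :> R.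
  rewrite -lnM ?posrE // ler_ln ?posrE ?mulr_gt0 //.
  by move: d2'; clear; lra.
have lnq : - ln 2 <= ln (1 - p).
  by rewrite -lnV ?posrE // ler_ln ?posrE //; move: p12; clear; lra.
have lnp2 : ln p <= - ln 2.
  by rewrite -lnV ?posrE // ler_ln ?posrE //; move: p12; clear; lra.
have lnd0 : 0 <= ln d%:R :> R by rewrite ln_ge0 //; move: d2'; clear; lra.
have lndl : ln c - 7 / 68 * L <= ln dl.
  apply: le_trans (_ : ln (c * n%:R `^ (- beta)) <= _); last first.
    rewrite ler_ln ?posrE ?mulr_gt0 ?powR_gt0 //.
    by move: dlc; rewrite ger0_norm ?powR_ge0 // ger0_norm // ltW.
  rewrite lnM ?posrE ?powR_gt0 // ln_powR -/L lerD2l mulNr lerN2.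
  by rewrite ler_wpM2r ?(ltW L0) //; case/andP: hbeta.
(* Cubing [H] turns its exponents 1/3 and 1/6 into 1 and 1/2, which is the relation between [s] and
   [H] below. *)
pose s := X `^ (1 / 2).
have s0 : 0 < s by apply: powR_gt0.
have powXn (x y : R) k : 0 <= x -> (x `^ y) ^+ k = x `^ (y * k%:R).
  by move=> x0; rewrite powRrM powR_mulrn ?powR_ge0.
have sL : s ^+ 2 * L = p * (1 - p) * n%:R.
  rewrite /s powXn ?ltW // (_ : 1 / 2 * 2%:R = 1); last by field.
  by rewrite powRr1 ?ltW // /X divfK // gt_eqF.
have sH : dl * s = 64 * (d%:R + 1) * H ^+ 3.
  rewrite /H !exprMn !powXn ?(ltW X0) ?(ltW Z0) //.
  rewrite (_ : 1 / 3 * 3%:R = 1); last by field.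
  rewrite (_ : 1 / 6 * 3%:R = 1 / 2); last by field.
  rewrite powRr1 ?(ltW Z0) // -/X -/s; field.
  by rewrite gt_eqF.
clearbody H.
have pH : C * d%:R * L <= p * H.
  have CdL0 : 0 < C * d%:R * L by rewrite !mulr_gt0.
  rewrite -ler_ln ?posrE ?(mulr_gt0 p0 H0) // !lnM ?posrE ?mulr_gt0 //.
  exact: (log_pH_ge l2_ge0 lnC lnd0 lnd1 lnq lnH lnp).
have Hdl : 8 <= H * dl.
  have Hdl0 : 0 < H * dl by rewrite mulr_gt0.
  have ln8 : ln (8 : R) = 3 * ln 2.
    by rewrite (_ : 8 = 2 ^+ 3 :> R) ?lnXn ?mulr_natl //; ring.
  have : ln (8 : R) <= ln (H * dl).
    rewrite ln8 lnM ?posrE //.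
    exact: (log_Hdelta_ge l2_ge0 lnC lnd0 lnd1 lnq lnH lnp l2_le1 lnp2 lndl).
  by rewrite ler_ln // posrE.
have dL1 : L <= d%:R * L.
  by rewrite ler_peMl ?(ltW L0) //; move: d2'; clear; lra.
have dL2 : d%:R <= d%:R * L by rewrite ler_peMr ?(ltW d0).
(* H >= 2 p H >= 2 C d L >= 4 * 180^2 L, by p <= 1/2 and d >= 2. *)
have HL : 360 ^+ 2 * L <= H.
  have : p * H <= 1 / 2 * H by rewrite ler_wpM2r // ltW.
  have : 180 ^+ 2 * (2 * L) <= C * (d%:R * L).
    by apply: ler_pM => //; [rewrite mulr_ge0 // ltW|rewrite ler_pM2r].
  by move: pH L0; rewrite -mulrA !expr2; clear; lra.
(* It remains to see that p H / 4 >= 45 d L outweighs 2 L + 2 d + 2 ln 2 - ln delta, where ln delta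
   >= - L. *)
apply: (@prob_separated_delta _ p dl H s) => //; rewrite ?p0 ?dl0 //.
have ln4 : ln (4 : R) = 2 * ln 2.
  by rewrite (_ : 4 = 2 ^+ 2 :> R) ?lnXn ?mulr_natl //; ring.
rewrite -/L -[leRHS]lnK ?posrE ?divr_gt0 // ler_expR ln_div ?posrE // ln4.
have CdL : 180 * (d%:R * L) <= C * d%:R * L.
  rewrite -mulrA ler_pM2r ?mulr_gt0 //; apply: le_trans C_ge.
  by rewrite expr2 ler_peMr ?ler0n ?ler1n.
have lncL : - L <= ln c - 7 / 68 * L.
  move: L_A (normr_ge0 (ln c)); rewrite /A; have := ler_norm (- ln c); rewrite normrN.
  by move: (`|ln c|) => y; clear; lra.
by move: lncL lndl pH CdL dL1 dL2 L1 l2_le1; clear; lra.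
Qed.
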